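(* Let $\mathcal{X}\subseteq\mathbb{R}^n$ and $\mathcal{Y}\subseteq\mathbb{R}^m$ be closed convex polyhedra, $\mathcal{D}=\mathcal{X}\times\mathcal{Y}$, and let $S:\mathcal{D}\to\mathbb{R}$ be convex-concave and continuously differentiable with Lipschitz continuous gradient and with at least one saddle point in $\mathcal{D}$. Suppose that $S(x,y)$ is $\mu$-strongly convex in $x$ and $q$-strongly concave in $y$, with constants $\mu,q>0$. Then the projected saddle flow dynamics $$\dot x=\Pi_{\mathcal{X}}[x,-\nabla_xS(x,y)],\qquad \dot y=\Pi_{\mathcal{Y}}[y,+\nabla_yS(x,y)]$$ are globally exponentially stable. More precisely, writing $z=(x,y)$, given the (unique) saddle point $z_\star$ of $S$ and any initial point $z(0)\in\mathcal{D}$, $$\|z(t)-z_\star\|\le\|z(0)-z_\star\|e^{-ct}$$ holds (for all $t\ge0$) with the rate $c=\min\{\mu,q\}>0$.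
   Context: $S$ is convex-concave if $S(\cdot,y)$ is convex on $\mathcal{X}$ for every $y\in\mathcal{Y}$ and $S(x,\cdot)$ is concave on $\mathcal{Y}$ for every $x\in\mathcal{X}$. A saddle point is a point $(x_\star,y_\star)\in\mathcal{D}$ with $S(x_\star,y)\le S(x_\star,y_\star)\le S(x,y_\star)$ for all $x\in\mathcal{X}$, $y\in\mathcal{Y}$. $\mu$-strongly convex in $x$ means $S(\cdot,y)-\frac{\mu}{2}\|\cdot\|^2$ is convex for every $y$; $q$-strongly concave in $y$ means $S(x,\cdot)+\frac{q}{2}\|\cdot\|^2$ is concave for every $x$. For a closed convex set $\mathcal{P}$, $p\in\mathcal{P}$ and a vector $s$, $\Pi_{\mathcal{P}}[p,s]:=\lim_{\delta\to0^+}\frac{\Psi_{\mathcal{P}}[p+\delta s]-p}{\delta}$, where $\Psi_{\mathcal{P}}[r]$ is the point of $\mathcal{P}$ closest to $r$. Trajectories are Carathéodory solutions (absolutely continuous, in $\mathcal{D}$, satisfying the equations for almost every $t\ge0$). *)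

(* Defs.v *)
From HB Require Import structures.
From mathcomp Require Import all_boot all_order all_algebra.
From mathcomp Require Import all_classical all_reals all_analysis.

Set Implicit Arguments.
Unset Strict Implicit.
Unset Printing Implicit Defensive.
Import Order.TTheory GRing.Theory Num.Theory.
Import numFieldNormedType.Exports.
Local Open Scope classical_set_scope.
Local Open Scope ring_scope.

(* R^n is 'rV[R]_n and R^n x R^m is 'rV[R]_(n + m), a point (x, y) being
   row_mx x y.  The library norm `|_| on row vectors is the sup norm, so the
   Euclidean structure is introduced here; the topology is the same. *)

Definition dotp (R : realType) (n : nat) (u v : 'rV[R]_n) : R :=
  \sum_(i < n) u 0 i * v 0 i.

Definition enorm (R : realType) (n : nat) (u : 'rV[R]_n) : R :=
  Num.sqrt (dotp u u).

Definition polyhedron (R : realType) (n : nat) (P : set 'rV[R]_n) : Prop :=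
  exists (k : nat) (a : 'I_k -> 'rV[R]_n) (b : 'I_k -> R),
    P = [set x | forall i, dotp (a i) x <= b i].

Definition prod_set (R : realType) (n m : nat) (X : set 'rV[R]_n)
    (Y : set 'rV[R]_m) : set 'rV[R]_(n + m) :=
  [set z | X (lsubmx z) /\ Y (rsubmx z)].

Definition convex_concave (R : realType) (n m : nat) (X : set 'rV[R]_n)
    (Y : set 'rV[R]_m) (S : 'rV[R]_(n + m) -> R) : Prop :=
  (forall y, Y y -> convex_function X (fun x => S (row_mx x y))) /\
  (forall x, X x -> convex_function Y (fun y => - S (row_mx x y))).

Definition strongly_convex_x (R : realType) (n m : nat) (mu : R)
    (X : set 'rV[R]_n) (Y : set 'rV[R]_m) (S : 'rV[R]_(n + m) -> R) : Prop :=
  forall y, Y y ->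
    convex_function X (fun x => S (row_mx x y) - mu / 2 * enorm x ^+ 2).

Definition strongly_concave_y (R : realType) (n m : nat) (q : R)
    (X : set 'rV[R]_n) (Y : set 'rV[R]_m) (S : 'rV[R]_(n + m) -> R) : Prop :=
  forall x, X x ->
    convex_function Y (fun y => - (S (row_mx x y) + q / 2 * enorm y ^+ 2)).

Definition saddle_point (R : realType) (n m : nat) (X : set 'rV[R]_n)
    (Y : set 'rV[R]_m) (S : 'rV[R]_(n + m) -> R) (zs : 'rV[R]_(n + m)) : Prop :=
  prod_set X Y zs /\
  forall x y, X x -> Y y ->
    S (row_mx (lsubmx zs) y) <= S zs /\ S zs <= S (row_mx x (rsubmx zs)).

(* [g] is a gradient of [f] on [D], differentiability at [z] being understood
   relative to [D] because [f] is meaningful only there.  When [D] has empty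
   interior [g] is determined only up to directions normal to [D]. *)
Definition gradient_on (R : realType) (k : nat) (D : set 'rV[R]_k)
    (f : 'rV[R]_k -> R) (g : 'rV[R]_k -> 'rV[R]_k) : Prop :=
  forall z, D z ->
    forall e : R, 0 < e ->
      \forall w \near within D (nbhs z),
        `|f w - f z - dotp (g z) (w - z)| <= e * enorm (w - z).

Definition lipschitz_on_set (R : realType) (k l : nat) (D : set 'rV[R]_k)
    (g : 'rV[R]_k -> 'rV[R]_l) : Prop :=
  exists L : R, forall z w, D z -> D w ->
    enorm (g z - g w) <= L * enorm (z - w).

Definition nearest_point (R : realType) (n : nat) (P : set 'rV[R]_n)
    (r : 'rV[R]_n) : 'rV[R]_n :=
  get [set p | P p /\ forall p', P p' -> enorm (r - p) <= enorm (r - p')].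

Definition proj_dir (R : realType) (n : nat) (P : set 'rV[R]_n)
    (p s : 'rV[R]_n) : 'rV[R]_n :=
  lim ((fun d : R => d^-1 *: (nearest_point P (p + d *: s) - p)) @ 0^'+).

Definition absolutely_continuous (R : realType) (k : nat) (a b : R)
    (f : R -> 'rV[R]_k) : Prop :=
  forall e : R, 0 < e -> exists2 d : R, 0 < d &
    forall (N : nat) (u v : 'I_N -> R),
      (forall i, [/\ a <= u i, u i <= v i & v i <= b]) ->
      trivIset setT (fun i => `]u i, v i[%classic) ->
      \sum_(i < N) (v i - u i) < d ->
      \sum_(i < N) enorm (f (v i) - f (u i)) < e.

(* Only the restriction of [z] to [0, +oo[ matters: the value at the single
   point 0 of the two-sided derivative is irrelevant almost everywhere. *)
Definition saddle_flow_solution (R : realType) (n m : nat) (X : set 'rV[R]_n)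
    (Y : set 'rV[R]_m) (gS : 'rV[R]_(n + m) -> 'rV[R]_(n + m))
    (z : R -> 'rV[R]_(n + m)) : Prop :=
  [/\ forall T : R, 0 <= T -> absolutely_continuous 0 T z,
      forall t : R, 0 <= t -> prod_set X Y (z t) &
      {ae lebesgue_measure, forall t : R, 0 <= t ->
        is_derive t 1 (fun s => lsubmx (z s))
          (proj_dir X (lsubmx (z t)) (- lsubmx (gS (z t)))) /\
        is_derive t 1 (fun s => rsubmx (z s))
          (proj_dir Y (rsubmx (z t)) (rsubmx (gS (z t))))}].

(* Main.v *)
(** Let V = |z - zs|^2.  For a polyhedron P and p in P, projecting p + d s for
    small d > 0 gives p + d u, where u is the nearest point to s in the tangent
    cone of P at p; hence Pi_P[p, s] = u and (w - p) . (s - u) <= 0 for w in P.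
    So V' is at most the value obtained with the unprojected velocity, and the
    gradient inequalities of strong convexity and concavity bound that by
    2 (S(xs, y) - S(x, ys)) - mu |x - xs|^2 - q |y - ys|^2.  Quadratic growth
    of S at the saddle point bounds 2 (S(xs, y) - S(x, ys)) by the same two
    negative terms, whence V' <= - 2 c V almost everywhere.  Finally
    V(t) exp(2 c t) is absolutely continuous with nonpositive derivative almost
    everywhere, hence nonincreasing. *)

Require Import Defs.
From HB Require Import structures.
From mathcomp Require Import all_boot all_order all_algebra.
From mathcomp Require Import all_classical all_reals all_analysis.
From mathcomp Require Import measurable_realfun.
From mathcomp Require Import ring lra.
Import Order.TTheory GRing.Theory Num.Theory.
Import numFieldNormedType.Exports.
Local Open Scope classical_set_scope.
Local Open Scope ring_scope.

(** * Euclidean structure *)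

Section euclidean.
Context {R : realType} {n : nat}.
Implicit Types (u v w : 'rV[R]_n) (a : R).

Lemma dotpC u v : dotp u v = dotp v u.
Proof. by apply: eq_bigr => i _; rewrite mulrC. Qed.

Lemma dotpDl u v w : dotp (u + v) w = dotp u w + dotp v w.
Proof. by rewrite -big_split; apply: eq_bigr => i _; rewrite !mxE mulrDl. Qed.

Lemma dotpZl a u v : dotp (a *: u) v = a * dotp u v.
Proof. by rewrite mulr_sumr; apply: eq_bigr => i _; rewrite !mxE mulrA. Qed.

Lemma dotpNl u v : dotp (- u) v = - dotp u v.
Proof. by rewrite -scaleN1r dotpZl mulN1r. Qed.

Lemma dotpDr u v w : dotp w (u + v) = dotp w u + dotp w v.
Proof. by rewrite dotpC dotpDl !(dotpC w). Qed.

Lemma dotpZr a u v : dotp u (a *: v) = a * dotp u v.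
Proof. by rewrite dotpC dotpZl dotpC. Qed.

Lemma dotpNr u v : dotp u (- v) = - dotp u v.
Proof. by rewrite dotpC dotpNl dotpC. Qed.

Lemma dotp0r u : dotp u 0 = 0.
Proof. by rewrite -(scale0r 0) dotpZr mul0r. Qed.

Definition dotpE := (dotpDl, dotpDr, dotpNl, dotpNr, dotpZl, dotpZr).

Lemma dotp_ge0 u : 0 <= dotp u u.
Proof. by apply: sumr_ge0 => i _; rewrite -expr2 sqr_ge0. Qed.

Lemma enorm_ge0 u : 0 <= enorm u.
Proof. exact: sqrtr_ge0. Qed.

Lemma sqr_enorm u : enorm u ^+ 2 = dotp u u.
Proof. by rewrite sqr_sqrtr // dotp_ge0. Qed.

Lemma ler_enorm u v : (enorm u <= enorm v) = (dotp u u <= dotp v v).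
Proof. by rewrite -!sqr_enorm ler_sqr ?nnegrE ?enorm_ge0. Qed.

Lemma dotp_eq0 u : (dotp u u == 0) = (u == 0).
Proof.
apply/eqP/eqP => [|->]; last exact: dotp0r.
move/eqP; rewrite psumr_eq0 => [/allP u0|i _]; last by rewrite -expr2 sqr_ge0.
apply/rowP => i; apply/eqP; rewrite mxE -[_ == 0]orbb -mulf_eq0.
exact: u0 (mem_index_enum i).
Qed.

Lemma enormZ a u : enorm (a *: u) = `|a| * enorm u.
Proof.
by rewrite /enorm dotpZl dotpZr mulrA -expr2 sqrtrM ?sqr_ge0 // sqrtr_sqr.
Qed.

Lemma enormN u : enorm (- u) = enorm u.
Proof. by rewrite -scaleN1r enormZ normrN1 mul1r. Qed.

(** Cauchy-Schwarz: the squared length of [dotp v v *: u - dotp u v *: v] is [dotp v v] times the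
    defect of the squared inequality. *)
Lemma dotp_le_enorm u v : dotp u v <= enorm u * enorm v.
Proof.
have [->|v0] := eqVneq v 0.
  by rewrite dotp0r mulr_ge0 ?enorm_ge0.
have vv : 0 < dotp v v by rewrite lt_neqAle dotp_ge0 eq_sym dotp_eq0 v0.
rewrite (le_trans (ler_norm _)) // -ler_sqr ?nnegrE ?mulr_ge0 ?enorm_ge0 //.
rewrite real_normK ?num_real // exprMn !sqr_enorm -subr_ge0.
have := dotp_ge0 (dotp v v *: u - dotp u v *: v).
rewrite !dotpE (dotpC v u).
rewrite (_ : (_ + _) = dotp v v * (dotp u u * dotp v v - dotp u v ^+ 2)).
  by rewrite pmulr_rge0.
by ring.
Qed.

Lemma ler_enormD u v : enorm (u + v) <= enorm u + enorm v.
Proof.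
rewrite -ler_sqr ?nnegrE ?addr_ge0 ?enorm_ge0 // sqrrD !sqr_enorm !dotpE.
by have := dotp_le_enorm u v; rewrite (dotpC v u); lra.
Qed.

Lemma ler_dist_enorm u v : `|enorm u - enorm v| <= enorm (u - v).
Proof.
have := ler_enormD (u - v) v; have := ler_enormD (v - u) u.
by rewrite !subrK -opprB enormN ler_norml; lra.
Qed.

Lemma normr_le_enorm u : `|u| <= enorm u.
Proof.
rewrite [leLHS]/Num.norm /= mx_normrE.
apply: bigmax_le; first exact: enorm_ge0.
move=> [i j] _ /=; rewrite (ord1 i) -ler_sqr ?nnegrE ?enorm_ge0 //.
rewrite real_normK ?num_real // sqr_enorm /dotp (bigD1 j) //= -expr2 lerDl.
by apply: sumr_ge0 => k _; rewrite -expr2 sqr_ge0.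
Qed.

Lemma continuous_dotp (w : 'rV[R]_n) : continuous (dotp w).
Proof.
apply: (@continuous_big R 'I_n +%R 0 xpredT _ _ _ (fun i v => w 0 i * v 0 i)).
  exact: add_continuous.
move=> i _ v; apply: continuousM; [exact: cst_continuous | exact: coord_continuous].
Qed.

Lemma continuous_dotp_diag : continuous (fun v : 'rV[R]_n => dotp v v).
Proof.
apply: (@continuous_big R 'I_n +%R 0 xpredT _ _ _ (fun i v => v 0 i * v 0 i)).
  exact: add_continuous.
move=> i _ v; apply: continuousM; exact: coord_continuous.
Qed.

End euclidean.

Lemma dotp_submx (R : realType) n m (u v : 'rV[R]_(n + m)) :
  dotp u v = dotp (lsubmx u) (lsubmx v) + dotp (rsubmx u) (rsubmx v).
Proof.
by rewrite /dotp big_split_ord; congr (_ + _); apply: eq_bigr => i _; rewrite !mxE.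
Qed.

Section row_mx_blocks.
Context {R : realType} {n m : nat}.

Lemma row_mx_segmentl (x x' : 'rV[R]_n) (y : 'rV[R]_m) l :
  row_mx x y + l *: row_mx (x' - x) 0 = row_mx (x + l *: (x' - x)) y.
Proof. by rewrite scale_row_mx add_row_mx scaler0 addr0. Qed.

Lemma row_mx_segmentr (x : 'rV[R]_n) (y y' : 'rV[R]_m) l :
  row_mx x y + l *: row_mx 0 (y' - y) = row_mx x (y + l *: (y' - y)).
Proof. by rewrite scale_row_mx add_row_mx scaler0 addr0. Qed.

Lemma dotp_row_mxl (z : 'rV[R]_(n + m)) (u : 'rV[R]_n) :
  dotp z (row_mx u 0) = dotp (lsubmx z) u.
Proof.
by rewrite dotp_submx row_mxKl row_mxKr dotp0r addr0.
Qed.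

Lemma dotp_row_mxr (z : 'rV[R]_(n + m)) (u : 'rV[R]_m) :
  dotp z (row_mx 0 u) = dotp (rsubmx z) u.
Proof.
by rewrite dotp_submx row_mxKl row_mxKr dotp0r add0r.
Qed.

End row_mx_blocks.

(** * Projection onto a polyhedron *)

Lemma polyhedron_segment (R : realType) k (P : set 'rV[R]_k) x y l : polyhedron P ->
  P x -> P y -> 0 <= l -> l <= 1 -> P (y + l *: (x - y)).
Proof.
move=> [N [a [b ->]]] Px Py l0 l1 i; rewrite !dotpE.
have := ler_wpM2l l0 (Px i).
have : (1 - l) * dotp (a i) y <= (1 - l) * b i by rewrite ler_wpM2l ?subr_ge0.
lra.
Qed.

(** The obtuse-angle condition yields [|r - q|^2 + |w - q|^2 <= |r - w|^2] on [P]. Hence [q] is a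
    minimiser, and the minimiser picked by [get] is at distance zero from it. *)
Lemma nearest_pointE (R : realType) n (P : set 'rV[R]_n) r q :
  P q -> (forall w, P w -> dotp (r - q) (w - q) <= 0) -> nearest_point P r = q.
Proof.
move=> Pq qvar.
have dist w : P w -> dotp (r - q) (r - q) + dotp (w - q) (w - q) <= dotp (r - w) (r - w).
  move=> /qvar; have -> : r - w = (r - q) - (w - q) by rewrite opprB subrKA.
  by move: (r - q) (w - q) => A B; rewrite !dotpE (dotpC B A); lra.
have [Pg gmin] : [set p | P p /\ forall p', P p' -> enorm (r - p) <= enorm (r - p')]
    (nearest_point P r).
  apply: getPex; exists q; split => // w Pw.
  by rewrite ler_enorm (le_trans _ (dist w Pw)) // lerDl dotp_ge0.
apply/eqP; rewrite -subr_eq0 -dotp_eq0 eq_le dotp_ge0 andbT.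
have := gmin _ Pq; rewrite ler_enorm => /(le_trans (dist _ Pg)).
by rewrite gerDl.
Qed.

Section polyhedral_projection.
Context {R : realType} {n k : nat}.
Variables (a : 'I_k -> 'rV[R]_n) (b : 'I_k -> R).
Implicit Types (p s u w : 'rV[R]_n).

Let P := [set x | forall i, dotp (a i) x <= b i].

(** For [p] in [P] these are the feasible directions, along which a short step stays in [P]. *)
Definition tangent_cone p : set 'rV[R]_n :=
  [set v | forall i, dotp (a i) p = b i -> dotp (a i) v <= 0].

Lemma tangent_coneB p w : P w -> tangent_cone p (w - p).
Proof. by move=> Pw i pi; rewrite !dotpE pi subr_le0. Qed.

Lemma closed_tangent_cone p : closed (tangent_cone p).
Proof.
rewrite (_ : tangent_cone p =
  \bigcap_(i in [set i | dotp (a i) p = b i]) (dotp (a i) @^-1` [set y | y <= 0])).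
  apply: closed_bigI => i _; apply: closed_comp; last exact: closed_le.
  by move=> v _; exact: continuous_dotp.
by apply/seteqP; split => v h i /=; exact: h.
Qed.

(** The squared distance to [s] attains its minimum on the compact part [K] of the cone; a cone
    point outside [K] is farther from [s] than [0], which lies in [K]. *)
Lemma tangent_cone_nearest p s :
  exists2 u, tangent_cone p u &
    forall v, tangent_cone p v -> enorm (s - u) <= enorm (s - v).
Proof.
pose K := tangent_cone p `&` [set u | dotp (s - u) (s - u) <= dotp s s].
have T0 : tangent_cone p 0 by move=> i _; rewrite dotp0r.
have K0 : K 0 by split => //=; rewrite subr0.
have cont : continuous (fun u => dotp (s - u) (s - u)).
  move=> u; apply: (@continuous_comp _ _ _ (fun u => s - u) (fun v => dotp v v)).
    by apply: continuousB; [exact: cst_continuous | move=> A; exact].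
  exact: continuous_dotp_diag.
have clK : closed K.
  apply: closedI; first exact: closed_tangent_cone.
  apply: (@closed_comp _ _ (fun u => dotp (s - u) (s - u)) [set y | y <= dotp s s]).
    by move=> v _; exact: cont.
  exact: closed_le.
have bK : bounded_set K.
  exists (enorm s + enorm s); split; first exact: num_real.
  move=> M lM u [_ /=]; rewrite -ler_enorm => su.
  rewrite (le_trans (normr_le_enorm u)) // (le_trans _ (ltW lM)) //.
  have := ler_enormD (u - s) s; rewrite subrK -opprB enormN => /le_trans; apply.
  by rewrite lerD2r.
have [u uK umin] := EVT_min_rV (ex_intro _ 0 K0) (bounded_closed_compact bK clK)
    (continuous_subspaceT cont).
move: uK; rewrite inE => -[Tu /= su]; exists u => // v Tv; rewrite ler_enorm.
have [sv|sv] := leP (dotp (s - v) (s - v)) (dotp s s).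
  by apply: umin; rewrite inE; split.
exact: le_trans su (ltW sv).
Qed.

(** Moreau decomposition: [s - u] lies in the polar cone and is orthogonal to [u]. The admissible
    variations at [u] are any [v] of the cone, since a cone is stable under addition, and [- u],
    since it is stable under shrinking. *)
Lemma tangent_cone_nearestP p s u : tangent_cone p u ->
  (forall v, tangent_cone p v -> enorm (s - u) <= enorm (s - v)) ->
  (forall v, tangent_cone p v -> dotp (s - u) v <= 0) /\ dotp (s - u) u = 0.
Proof.
move=> Tu umin.
(* If [A := (s - u) . v > 0], then the step [A / (A + |v|^2)] along [v] brings
   [u] closer to [s]. *)
have variation v : (forall l, 0 < l -> l <= 1 -> tangent_cone p (u + l *: v)) ->
    dotp (s - u) v <= 0.
  move=> Tv; rewrite leNgt; apply/negP => A0.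
  have B0 := dotp_ge0 v.
  have AB0 : 0 < dotp (s - u) v + dotp v v by rewrite ltr_pwDl.
  pose l := dotp (s - u) v / (dotp (s - u) v + dotp v v).
  have l0 : 0 < l by rewrite divr_gt0.
  have l1 : l <= 1 by rewrite ler_pdivrMr // mul1r lerDl.
  have lAB : l * (dotp (s - u) v + dotp v v) = dotp (s - u) v.
    by rewrite divfK // gt_eqF.
  have := umin _ (Tv l l0 l1); rewrite ler_enorm opprD addrA.
  have -> A : dotp (A - l *: v) (A - l *: v) =
      dotp A A - l * (dotp A v *+ 2 - l * dotp v v).
    by rewrite !dotpE (dotpC v); ring.
  rewrite lerBrDr gerDl leNgt pmulr_rgt0 // => /negP; apply.
  have : l * dotp v v <= dotp (s - u) v.
    by rewrite -[leRHS]lAB ler_pM2l // lerDr ltW.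
  by rewrite mulr2n; lra.
have Tcone v : tangent_cone p v -> dotp (s - u) v <= 0.
  move=> Tv; apply: variation => l l0 _ i api; rewrite !dotpE.
  have := Tu i api; have : l * dotp (a i) v <= 0.
    by rewrite mulr_ge0_le0 ?(ltW l0) //; exact: Tv.
  by lra.
split=> //; apply/eqP; rewrite eq_le Tcone //= -oppr_le0 -dotpNr.
apply: variation => l _ l1 i api; rewrite !dotpE.
rewrite mulrN -[X in X - _]mul1r -mulrBl mulr_ge0_le0 ?subr_ge0 //; exact: Tu.
Qed.

(** Active constraints do not increase along [u], inactive ones have slack for a short step, and
    there are finitely many constraints. *)
Lemma tangent_cone_feasible p u : P p -> tangent_cone p u ->
  \forall d \near 0^'+, P (p + d *: u).
Proof.
move=> Pp Tu; apply: filter_forall => i.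
have [api|api] := eqVneq (dotp (a i) p) (b i).
  near=> d; rewrite !dotpE api gerDl mulr_ge0_le0 //; last exact: Tu.
have c0 : 0 < b i - dotp (a i) p by rewrite subr_gt0 lt_neqAle api Pp.
have M0 : 0 < `|dotp (a i) u| + 1 by rewrite ltr_wpDl.
near=> d.
have d0 : 0 < d by near: d; exact: nbhs_right_gt.
have dlt : d < (b i - dotp (a i) p) / (`|dotp (a i) u| + 1).
  by near: d; apply: nbhs_right_lt; rewrite divr_gt0.
rewrite !dotpE -lerBrDl; move: dlt; rewrite ltr_pdivlMr // => /ltW; apply: le_trans.
by rewrite ler_pM2l // (le_trans (ler_norm _)) // lerDl.
Unshelve. all: by end_near. Qed.

(** The difference quotient is eventually constant: for small [d] the nearest point to [p + d *: s]
    is exactly [p + d *: u]. *)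
Lemma proj_dirE p s u : P p -> tangent_cone p u ->
  (forall v, tangent_cone p v -> enorm (s - u) <= enorm (s - v)) ->
  proj_dir P p s = u.
Proof.
move=> Pp Tu umin; have [Tle0 Tu0] := tangent_cone_nearestP _ _ _ Tu umin.
apply: lim_near_cst; first exact: norm_hausdorff.
near=> d.
have d0 : 0 < d by near: d; exact: nbhs_right_gt.
rewrite (@nearest_pointE _ _ _ _ (p + d *: u)).
- by rewrite addrAC subrr add0r scalerA mulVf ?gt_eqF // scale1r.
- by near: d; exact: tangent_cone_feasible.
- move=> w Pw.
  (* The residual is [d *: (s - u)]; it is orthogonal to [u], so only its product with [w - p]
     remains, and [w - p] is tangent. *)
  rewrite opprD addrACA subrr add0r -scalerBr dotpZl addrA.
  rewrite [dotp _ (_ - _ - _)]dotpDr dotpNr dotpZr Tu0 mulr0 subr0.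
  by rewrite mulr_ge0_le0 ?(ltW d0) //; apply: Tle0; exact: tangent_coneB.
Unshelve. all: by end_near. Qed.

End polyhedral_projection.

Lemma proj_dir_polyhedron (R : realType) n (P : set 'rV[R]_n) p s w :
  polyhedron P -> P p -> P w ->
  dotp (w - p) (s - proj_dir P p s) <= 0.
Proof.
move=> [k [a [b ->]]] Pp Pw.
have [u Tu umin] := tangent_cone_nearest a b p s.
rewrite (proj_dirE _ _ _ _ _ Pp Tu umin) dotpC.
exact: (tangent_cone_nearestP _ _ _ _ _ Tu umin).1 _ (tangent_coneB _ _ _ _ Pw).
Qed.

(** * Strong convexity *)

(** The case [G = 0] gives quadratic growth away from a minimiser. *)
Lemma strong_convexity_slope (R : realType) (phi : R -> R) (G k : R) :
  (forall l, 0 <= l -> l <= 1 ->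
     phi l <= l * phi 1 + (1 - l) * phi 0 - k * (l * (1 - l))) ->
  (forall e, 0 < e -> \forall l \near 0^'+, - (e * l) <= phi l - phi 0 - l * G) ->
  G + k <= phi 1 - phi 0.
Proof.
move=> cvx slope; rewrite leNgt; apply/negP => lt.
(* Half the assumed gap: the slope error and the term [k * l] are each worth at most [e], the latter
   strictly less, so together they cannot fill the gap. *)
pose e := (G + k - (phi 1 - phi 0)) / 2.
have e0 : 0 < e by rewrite divr_gt0 // subr_gt0.
near (0:R)^'+ => l.
have l0 : 0 < l by near: l; exact: nbhs_right_gt.
have l1 : l <= 1 by near: l; exact: nbhs_right_le.
have kl : `|k| * l < e.
  apply: (@le_lt_trans _ _ ((`|k| + 1) * l)); first by rewrite ler_pM2r // lerDl.
  rewrite mulrC -ltr_pdivlMr ?ltr_wpDl //.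
  by near: l; apply: nbhs_right_lt; rewrite divr_gt0 // ltr_wpDl.
have := cvx _ (ltW l0) l1.
have : - (e * l) <= phi l - phi 0 - l * G by near: l; exact: slope.
move=> h1 h2.
have : l * (G + k - (phi 1 - phi 0)) <= l * (e + k * l) by lra.
rewrite ler_pM2l // => h3.
have := ler_norm (k * l); rewrite normrM (gtr0_norm l0).
by rewrite /e in h3 kl *; lra.
Unshelve. all: by end_near. Qed.

Section strong_convexity.
Context {R : realType} {k : nat}.
Implicit Types (D : set 'rV[R]_k) (f : 'rV[R]_k -> R) (kappa : R).

Lemma convex_function_segment D f : convex_function D f ->
  forall x y l, D x -> D y -> 0 <= l -> l <= 1 ->
    f (y + l *: (x - y)) <= l * f x + (1 - l) * f y.
Proof.
move=> cvx x y l Dx Dy l0 l1.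
have := cvx (Itv01 l0 l1) x y; rewrite !inE => /(_ Dx Dy).
suff -> : y + l *: (x - y) = l *: x + (1 - l) *: y by [].
by rewrite scalerBr scalerBl scale1r addrCA.
Qed.

(** The extra term comes from the identity [|y + l (x - y)|^2 = l |x|^2 + (1 - l) |y|^2 - l (1 - l)
    |x - y|^2]. *)
Lemma strongly_convex_segment D f kappa :
  convex_function D (fun x => f x - kappa / 2 * enorm x ^+ 2) ->
  forall x y l, D x -> D y -> 0 <= l -> l <= 1 ->
    f (y + l *: (x - y)) <= l * f x + (1 - l) * f y
      - kappa / 2 * dotp (x - y) (x - y) * (l * (1 - l)).
Proof.
move=> /convex_function_segment cvx x y l Dx Dy l0 l1.
have := cvx x y l Dx Dy l0 l1; rewrite !sqr_enorm !dotpE (dotpC y x).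
lra.
Qed.

End strong_convexity.

Lemma gradient_on_segment (R : realType) k (D : set 'rV[R]_k) f g (z d : 'rV[R]_k) :
  gradient_on D f g -> D z -> (forall l, 0 <= l -> l <= 1 -> D (z + l *: d)) ->
  forall e, 0 < e -> \forall l \near 0^'+,
    `|f (z + l *: d) - f z - l * dotp (g z) d| <= e * l.
Proof.
move=> gf Dz Dzd e e0.
(* The added [1] keeps the divisor of [e] positive when [d = 0]. *)
have d1 : 0 < enorm d + 1 by rewrite ltr_wpDl ?enorm_ge0.
have : (z + l *: d) @[l --> 0^'+] --> z.
  rewrite -[X in _ --> X]addr0 -[X in _ + X](scale0r d).
  apply: cvgD; first exact: cvg_cst.
  by apply: cvgZl; apply: cvg_at_right_filter; exact: cvg_id.
move=> /(_ _ (gf z Dz _ (divr_gt0 e0 d1))) /= near_gf.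
near=> l.
have l0 : 0 < l by near: l; exact: nbhs_right_gt.
have l1 : l <= 1 by near: l; exact: nbhs_right_le.
have : D (z + l *: d) by apply: Dzd => //; exact: ltW.
have /[apply] : D (z + l *: d) ->
    `|f (z + l *: d) - f z - dotp (g z) (z + l *: d - z)|
      <= e / (enorm d + 1) * enorm (z + l *: d - z) by near: l.
rewrite [z + l *: d - z]addrAC subrr add0r dotpZr => /le_trans; apply.
rewrite enormZ (gtr0_norm l0) -mulrA ler_pM2l // mulrCA ger_pMr //.
by rewrite ler_pdivrMl // mulr1 lerDl.
Unshelve. all: by end_near. Qed.

(** * Absolute continuity *)

Section absolutely_continuous_real.
Context {R : realType}.
Implicit Types (f g : R -> R) (a b : R).

(** The scalar counterpart of [absolutely_continuous], applied below to distances and their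
    products. *)
Definition ac_on a b f := forall e : R, 0 < e -> exists2 d : R, 0 < d &
  forall (N : nat) (u v : 'I_N -> R),
    (forall i, [/\ a <= u i, u i <= v i & v i <= b]) ->
    trivIset setT (fun i => `]u i, v i[%classic) ->
    \sum_(i < N) (v i - u i) < d ->
    \sum_(i < N) `|f (v i) - f (u i)| < e.

Lemma ac_on_enorm n a b (z : R -> 'rV[R]_n) c :
  absolutely_continuous a b z -> ac_on a b (fun t => enorm (z t - c)).
Proof.
move=> ac e /ac[d d0 acd]; exists d => // N u v uv tuv /(acd _ _ _ uv tuv).
apply: le_lt_trans; apply: ler_sum => i _.
by rewrite (le_trans (ler_dist_enorm _ _)) // opprB subrKA.
Qed.

Lemma ac_on_lipschitz a b f (L : R) :
  (forall u v, a <= u -> u <= v -> v <= b -> `|f v - f u| <= L * (v - u)) ->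
  ac_on a b f.
Proof.
move=> fL e e0; have L0 : 0 < `|L| + 1 by rewrite ltr_wpDl.
exists (e / (`|L| + 1)) => [|N u v uv _]; first exact: divr_gt0.
rewrite ltr_pdivlMr // mulr_suml; apply: le_lt_trans.
apply: ler_sum => i _; have [au uvi vb] := uv i.
rewrite (le_trans (fL _ _ au uvi vb)) // mulrC ler_wpM2l ?subr_ge0 //.
by rewrite (le_trans (ler_norm L)) // lerDl.
Qed.

Lemma ac_on_uniform a b f : ac_on a b f ->
  forall e : R, 0 < e -> exists2 d : R, 0 < d &
    forall u v, a <= u -> u <= v -> v <= b -> v - u < d -> `|f v - f u| < e.
Proof.
move=> ac e /ac[d d0 acd]; exists d => // u v au uv vb vud.
have := acd 1%N (fun=> u) (fun=> v); rewrite !big_ord1; apply=> //.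
by move=> i j _ _ _; rewrite (ord1 i) (ord1 j).
Qed.

(** Finitely many steps of length [d / 2] cross the interval, and [f] changes by less than [1] over
    each. *)
Lemma ac_on_bounded a b f : ac_on a b f ->
  exists2 M : R, 0 < M & forall t, a <= t -> t <= b -> `|f t| <= M.
Proof.
move=> /ac_on_uniform/(_ 1 ltr01)[d d0 fd].
have h0 : 0 < d / 2 by rewrite divr_gt0.
have step (j : nat) t : a <= t -> t <= b -> t <= a + j%:R * (d / 2) ->
    `|f t - f a| <= j%:R.
  elim: j t => [|j IH] t a_t tb.
    rewrite mul0r addr0 => ta.
    by have -> : t = a; [exact: le_anti (introT andP (conj ta a_t))|rewrite subrr normr0].
  have [/(IH _ a_t tb) ft _|lt tle] := leP t (a + j%:R * (d / 2)).
    by rewrite (le_trans ft) // ler_nat.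
  set s := a + _ in lt.
  have a_s : a <= s by rewrite lerDl mulr_ge0 // ltW.
  have sb := le_trans (ltW lt) tb.
  have fs := IH _ a_s sb (lexx _).
  have ts : t - s < d.
    by rewrite -natr1 mulrDl mul1r addrA -/s in tle; lra.
  have ft := fd _ _ a_s (ltW lt) tb ts.
  by rewrite -(subrKA (f s)) -natr1 addrC (le_trans (ler_normD _ _)) // lerD // ltW.
pose j := Num.bound `|(b - a) / (d / 2)|.
have bj : b <= a + j%:R * (d / 2).
  rewrite -lerBlDl -ler_pdivrMr //.
  exact: le_trans (ler_norm _) (ltW (archi_boundP (normr_ge0 _))).
exists (j%:R + `|f a| + 1) => [|t a_t tb]; first by rewrite ltr_wpDl ?addr_ge0.
have := step j t a_t tb (le_trans tb bj).
have := ler_normD (f t - f a) (f a); rewrite subrK; lra.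
Qed.

Lemma ac_on_mul a b f g : ac_on a b f -> ac_on a b g -> ac_on a b (f \* g).
Proof.
move=> acf acg e e0.
have [M M0 fM] := ac_on_bounded _ _ _ acf.
have [K K0 gK] := ac_on_bounded _ _ _ acg.
(* Increments of [f] will be multiplied by values of [g], bounded by [K], and conversely with [M];
   each product gets half of [e]. *)
have [d d0 fd] := acf (e / 2 / K) (divr_gt0 (divr_gt0 e0 (ltr0Sn _ 1)) K0).
have [c c0 gc] := acg (e / 2 / M) (divr_gt0 (divr_gt0 e0 (ltr0Sn _ 1)) M0).
exists (Num.min d c) => [|N u v uv tuv]; first by rewrite lt_min d0.
rewrite lt_min => /andP[/(fd _ _ _ uv tuv) + /(gc _ _ _ uv tuv)].
rewrite (ltr_pdivlMr _ _ K0) (ltr_pdivlMr _ _ M0) !mulr_suml => ltf ltg.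
rewrite [ltRHS]splitr.
apply: le_lt_trans (ltrD ltf ltg); rewrite -big_split /=.
apply: ler_sum => i _; have [au uvi vb] := uv i.
have -> : f (v i) * g (v i) - f (u i) * g (u i) =
  (f (v i) - f (u i)) * g (v i) + (g (v i) - g (u i)) * f (u i) by ring.
rewrite (le_trans (ler_normD _ _)) // !normrM lerD // ler_wpM2l //.
  by apply: gK => //; exact: le_trans au uvi.
by apply: fM => //; exact: le_trans uvi vb.
Qed.

(** The factor [s - t] treats both sides of [t] at once: after division, [f] grows at rate at most
    [e] both from [t] to the right and from the left up to [t]. *)
Lemma is_derive_le0_slope f (t l : R) : is_derive t 1 f l -> l <= 0 ->
  forall e : R, 0 < e -> exists2 r : R, 0 < r &
    forall s, `|s - t| < r -> (f s - f t) * (s - t) <= e * (s - t) ^+ 2.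
Proof.
move=> [df <-] l0 e e0.
move/cvgrPdist_le : df => /(_ e e0) [r /= r0 fr]; exists r => // s st.
have [->|nst] := eqVneq s t; first by rewrite !subrr mulr0 expr0n mulr0.
have h0 : s - t != 0 by rewrite subr_eq0.
have := fr (s - t); rewrite /= sub0r normrN => /(_ st h0).
rewrite [_%:A]mulr1 subrK -[lim _]/('D_1 f t) distrC => /(le_trans (ler_norm _)).
rewrite lerBlDr => le_e.
rewrite -[X in X * _](mulVKf h0) mulrAC -expr2 mulrC ler_pM2r ?exprn_even_gt0 //.
by apply: le_trans le_e _; rewrite gerDl.
Qed.

(** Serves to append an interval to a finite disjoint family; the new member gets index [ord0]. *)
Lemma trivIset_unlift N (F : 'I_N -> set R) (B : set R) :
  trivIset setT F -> (forall i, F i `&` B = set0) ->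
  trivIset setT (fun i : 'I_N.+1 => if unlift ord0 i is Some j then F j else B).
Proof.
move=> tF FB; apply/trivIsetP => i j _ _.
case: (unliftP ord0 i) => [i'|] ->; case: (unliftP ord0 j) => [j'|] -> //=.
- by move=> ij; apply: (trivIsetP.1 tF) => //; apply: contra_neq ij => ->.
- by rewrite setIC => _; rewrite FB.
Qed.

Lemma lebesgue_sum_itv N (u v : 'I_N -> R) (U : set R) (d : R) :
  (forall i, u i <= v i) -> trivIset setT (fun i => `]u i, v i[%classic) ->
  (forall i, `]u i, v i[%classic `<=` U) -> open U ->
  (lebesgue_measure U < d%:E)%E ->
  \sum_(i < N) (v i - u i) < d.
Proof.
move=> uv tuv uvU oU muU; rewrite -lte_fin -sumEFin.
apply: le_lt_trans muU.
have mU : measurable U by exact: open_measurable.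
have mS : measurable (\big[setU/set0]_(i < N) `]u i, v i[%classic).
  by apply: bigsetU_measurable => i _; exact: measurable_itv.
rewrite (eq_bigr (fun i => lebesgue_measure `]u i, v i[%classic)); last first.
  move=> i _; rewrite lebesgue_measure_itv /= lte_fin.
  by case: ltgtP (uv i) => // ->; rewrite subrr.
rewrite -measure_semi_additive_ord //.
apply: le_measure; [exact: mem_set | exact: mem_set |].
by apply: (big_ind (fun A => A `<=` U)) => // [A B AU BU x [/AU|/BU]].
Qed.

(** Outer regularity of Lebesgue measure, applied to a measurable null set containing [A]. *)
Lemma negligible_open_cover (A : set R) (d : R) :
  lebesgue_measure.-negligible A -> 0 < d ->
  exists U, [/\ open U, A `<=` U & (lebesgue_measure U < d%:E)%E].
Proof.
move=> [B [mB B0 AB]] d0.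
have Boo : (lebesgue_measure B < +oo)%E by rewrite B0.
have [U [oU BU UB]] := lebesgue_regularity_outer mB Boo d0.
exists U; split => //; first exact: subset_trans BU.
have mU : measurable U by exact: open_measurable.
rewrite -(setDUK BU); apply: le_lt_trans UB.
rewrite -[leRHS]add0e -B0.
by apply: measureU2 => //; exact: measurableD.
Qed.

(** A derivative sign almost everywhere is not enough by itself, as the Cantor function shows;
    absolute continuity bounds the growth hidden in the exceptional null set. *)
Lemma ac_on_nonincreasing a b f : a <= b -> ac_on a b f ->
  {ae lebesgue_measure, forall t, a <= t -> t <= b ->
     exists2 l : R, is_derive t 1 f l & l <= 0} ->
  f b <= f a.
Proof.
move=> ab ac df.
have main e : 0 < e -> f b - f a <= e * (b - a) + e.
  move=> e0; have [d d0 acd] := ac e e0.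
  have [U [oU dfU Ud]] := negligible_open_cover _ _ df d0.
  (* [U] covers the exceptional times.  The supremum of the [t] for which the
     growth of [f] on [[a, t]] is controlled by [e * (t - a)] plus the variation
     of [f] over disjoint intervals inside [U] is [b]; that variation is below
     [e] because [U] has measure below [d]. *)
  pose gain t := exists N (u v : 'I_N -> R),
    [/\ forall i, [/\ a <= u i, u i <= v i & v i <= t],
        trivIset setT (fun i => `]u i, v i[%classic),
        forall i, `]u i, v i[%classic `<=` U &
        f t - f a <= e * (t - a) + \sum_(i < N) `|f (v i) - f (u i)|].
  have gain_slope s t : gain s -> s <= t -> f t - f s <= e * (t - s) -> gain t.
    move=> [N [u [v [uvs tuv uvU fs]]]] st fst; exists N, u, v; split => //.
      by move=> i; have [? ? vs] := uvs i; split => //; exact: le_trans st.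
    by lra.
  have gain_cover s t : gain s -> a <= s -> s <= t -> `]s, t[ `<=` U -> gain t.
    move=> [N [u [v [uvs tuv uvU fs]]]] a_s st stU.
    pose u' (i : 'I_N.+1) := if unlift ord0 i is Some j then u j else s.
    pose v' (i : 'I_N.+1) := if unlift ord0 i is Some j then v j else t.
    have u'v'E i : `]u' i, v' i[%classic =
        if unlift ord0 i is Some j then `]u j, v j[%classic else `]s, t[%classic.
      by rewrite /u' /v'; case: (unlift ord0 i).
    exists N.+1, u', v'; split.
    - move=> i; rewrite /u' /v'; case: (unlift ord0 i) => [j|]; last by split.
      by have [? ? vs] := uvs j; split => //; exact: le_trans st.
    - rewrite (funext u'v'E); apply: trivIset_unlift => // j.
      apply/seteqP; split => // x [] /=; rewrite !in_itv /= => /andP[_ xv] /andP[sx _].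
      by have [_ _ vs] := uvs j; have := lt_le_trans xv vs; rewrite ltNge (ltW sx).
    - by move=> i; rewrite u'v'E; case: (unlift ord0 i) => [j|//]; exact: uvU.
    - rewrite big_ord_recl /u' /v' unlift_none.
      under eq_bigr do rewrite liftK.
      have := ler_norm (f t - f s); have : e * s <= e * t by rewrite ler_pM2l.
      lra.
  (* Off [U] the derivative at [s] only compares values with [f s], whence the requirement that [x]
     or [y] be [s]. *)
  have local s : a <= s -> s <= b -> exists2 r : R, 0 < r & forall x y, gain x ->
      a <= x -> x <= y -> y <= b -> s - r < x -> y < s + r -> (x = s \/ y = s) -> gain y.
    move=> a_s sb; have [Us|nUs] := pselect (U s).
      have /nbhs_ballP[r /= r0 rU] : nbhs s U by exact: open_nbhs_nbhs.
      exists r => // x y gx a_x xy yb rx yr _; apply: (gain_cover _ _ gx a_x xy).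
      move=> w /=; rewrite in_itv /= => /andP[xw wy]; apply: rU.
      by rewrite /ball /= ltr_norml; lra.
    have [l sl l0] : exists2 l : R, is_derive s 1 f l & l <= 0.
      by apply: contrapT => nl; apply/nUs/dfU => /(_ a_s sb).
    have [r r0 fr] := is_derive_le0_slope _ _ _ sl l0 e e0.
    exists r => // x y gx a_x xy yb rx yr xys; apply: (gain_slope _ _ gx xy).
    move: xy; rewrite le_eqVlt => /predU1P[->|xy]; first by rewrite !subrr mulr0.
    have yx0 : 0 < y - x by rewrite subr_gt0.
    rewrite -(ler_pM2r yx0); case: xys => [xs|ys].
      rewrite -mulrA -expr2 xs; apply: fr; rewrite ltr_norml; lra.
    have : `|x - s| < r by rewrite ltr_norml; lra.
    by move=> /fr; rewrite ys; lra.
  have gain_a : gain a.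
    exists 0%N, (fun=> a), (fun=> a).
    by split=> [[]//|[]//|[]//|]; rewrite big_ord0 !subrr mulr0 addr0.
  pose G := [set t | [/\ a <= t, t <= b & gain t]].
  have Ga : G a by split.
  have supG : has_sup G by split; [exists a | exists b => t []].
  set s := sup G.
  have a_s : a <= s by apply: sup_upper_bound.
  have sb : s <= b by apply: sup_le_ub => [|t []//]; exists a.
  have [r r0 step] := local s a_s sb.
  (* The supremum is attained: a point of [G] close to [s] on its left passes the property on to
     [s]. *)
  have gain_s : gain s.
    have [t [a_t tb gt] rt] := sup_adherent r0 supG.
    have ts : t <= s by apply: sup_upper_bound.
    by apply: step gt a_t ts sb rt _ _; [rewrite ltrDl | right].
  (* If [s < b], a step to the right of [s] would stay in [G] and contradict the supremum. *)
  have s_b : s = b.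
    apply/eqP; rewrite eq_le sb leNgt; apply/negP => ltsb.
    pose t := Num.min b (s + r / 2).
    have st : s < t by rewrite lt_min ltsb ltrDl divr_gt0.
    have tb : t <= b by rewrite ge_min lexx.
    have tr : t < s + r by rewrite gt_min ltrD2l; lra.
    have gt : gain t.
      by apply: step gain_s a_s (ltW st) tb _ tr _; [rewrite gtrBl | left].
    have : t <= s by apply: sup_upper_bound => //; split=> //; exact: le_trans (ltW st).
    by rewrite leNgt st.
  move: gain_s; rewrite s_b => -[N [u [v [uvb tuv uvU fb]]]].
  rewrite (le_trans fb) // lerD2l ltW // acd //.
  by apply: lebesgue_sum_itv uvU oU Ud => // i; have [] := uvb i.
rewrite -subr_le0; apply/ler_addgt0Pr => e e0; rewrite add0r.
(* With tolerance [e / (b - a + 1)] the bound of [main] adds up to exactly [e]. *)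
have ba1 : 0 < b - a + 1 by rewrite ltr_wpDl // subr_ge0.
apply: le_trans (main _ (divr_gt0 e0 ba1)) _.
by rewrite -[X in _ + X]mulr1 -mulrDr divfK // gt_eqF.
Qed.

End absolutely_continuous_real.

(** * Saddle flow *)

Lemma prod_set_row_mx (R : realType) n m (X : set 'rV[R]_n) (Y : set 'rV[R]_m)
    x y : X x -> Y y -> prod_set X Y (row_mx x y).
Proof. by move=> Xx Yy; rewrite /prod_set /= row_mxKl row_mxKr. Qed.

Section saddle.
Context (R : realType) (n m : nat) (X : set 'rV[R]_n) (Y : set 'rV[R]_m).
Variables (S : 'rV[R]_(n + m) -> R) (gS : 'rV[R]_(n + m) -> 'rV[R]_(n + m)).
Variables (mu q : R).
Hypotheses (X_polyhedron : polyhedron X) (Y_polyhedron : polyhedron Y).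
Hypothesis S_gradient : gradient_on (prod_set X Y) S gS.
Hypothesis S_strongly_convex : strongly_convex_x mu X Y S.
Hypothesis S_strongly_concave : strongly_concave_y q X Y S.

Lemma strongly_convex_segment_x x x' y l : X x -> X x' -> Y y -> 0 <= l -> l <= 1 ->
  S (row_mx (x + l *: (x' - x)) y) <= l * S (row_mx x' y) + (1 - l) * S (row_mx x y)
    - mu / 2 * dotp (x' - x) (x' - x) * (l * (1 - l)).
Proof.
by move=> Xx Xx' Yy; exact: strongly_convex_segment (S_strongly_convex y Yy) _ _ _ _ _.
Qed.

Lemma strongly_concave_segment_y x y y' l : X x -> Y y -> Y y' -> 0 <= l -> l <= 1 ->
  - S (row_mx x (y + l *: (y' - y))) <=
    l * - S (row_mx x y') + (1 - l) * - S (row_mx x y)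
    - q / 2 * dotp (y' - y) (y' - y) * (l * (1 - l)).
Proof.
move=> Xx Yy Yy'.
have cvx : convex_function Y (fun y => - S (row_mx x y) - q / 2 * enorm y ^+ 2).
  by move=> t u v; have := S_strongly_concave x Xx t u v; rewrite !opprD.
exact: strongly_convex_segment cvx _ _ _ _ _.
Qed.

(** [strong_convexity_slope] on the segment from [x] to [x'], with [G] the directional derivative;
    convexity of [X] keeps the segment in the domain. *)
Lemma strong_gradient_x x x' y : X x -> X x' -> Y y ->
  dotp (lsubmx (gS (row_mx x y))) (x' - x) + mu / 2 * dotp (x' - x) (x' - x)
    <= S (row_mx x' y) - S (row_mx x y).
Proof.
move=> Xx Xx' Yy.
have /= := @strong_convexity_slope R (fun l => S (row_mx (x + l *: (x' - x)) y))
  (dotp (lsubmx (gS (row_mx x y))) (x' - x)) (mu / 2 * dotp (x' - x) (x' - x)).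
rewrite scale0r addr0 scale1r subrKC; apply; first by move=> l; exact: strongly_convex_segment_x.
move=> e e0.
have seg l : 0 <= l -> l <= 1 -> prod_set X Y (row_mx x y + l *: row_mx (x' - x) 0).
  move=> l0 l1; rewrite row_mx_segmentl; apply: prod_set_row_mx => //.
  exact: polyhedron_segment.
have := gradient_on_segment _ _ _ _ _ _ _ S_gradient
  (prod_set_row_mx _ _ _ X Y _ _ Xx Yy) seg e e0.
apply: filterS => l; rewrite row_mx_segmentl dotp_row_mxl ler_norml.
by case/andP.
Qed.

Lemma strong_gradient_y x y y' : X x -> Y y -> Y y' ->
  S (row_mx x y') - S (row_mx x y) <=
  dotp (rsubmx (gS (row_mx x y))) (y' - y) - q / 2 * dotp (y' - y) (y' - y).
Proof.
move=> Xx Yy Yy'.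
have /= := @strong_convexity_slope R (fun l => - S (row_mx x (y + l *: (y' - y))))
  (- dotp (rsubmx (gS (row_mx x y))) (y' - y)) (q / 2 * dotp (y' - y) (y' - y)).
rewrite scale0r addr0 scale1r subrKC => slope.
suff : - dotp (rsubmx (gS (row_mx x y))) (y' - y) + q / 2 * dotp (y' - y) (y' - y)
    <= - S (row_mx x y') - - S (row_mx x y) by lra.
apply: slope; first by move=> l; exact: strongly_concave_segment_y.
move=> e e0.
have seg l : 0 <= l -> l <= 1 -> prod_set X Y (row_mx x y + l *: row_mx 0 (y' - y)).
  move=> l0 l1; rewrite row_mx_segmentr; apply: prod_set_row_mx => //.
  exact: polyhedron_segment.
have := gradient_on_segment _ _ _ _ _ _ _ S_gradient
  (prod_set_row_mx _ _ _ X Y _ _ Xx Yy) seg e e0.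
apply: filterS => l; rewrite row_mx_segmentr dotp_row_mxr ler_norml => /andP[_].
lra.
Qed.

(** [lsubmx zs] minimises [S] over [X] with [y] fixed at [rsubmx zs], so slope [G = 0] is admissible
    on every segment leaving it. *)
Lemma saddle_growth_x zs x : saddle_point X Y S zs -> X x ->
  mu / 2 * dotp (x - lsubmx zs) (x - lsubmx zs) <= S (row_mx x (rsubmx zs)) - S zs.
Proof.
move=> [[Xs Ys] sad] Xx.
have /= := @strong_convexity_slope R
  (fun l => S (row_mx (lsubmx zs + l *: (x - lsubmx zs)) (rsubmx zs))) 0
  (mu / 2 * dotp (x - lsubmx zs) (x - lsubmx zs)).
rewrite scale0r addr0 scale1r subrKC hsubmxK add0r; apply.
  by move=> l l0 l1; have := strongly_convex_segment_x _ _ _ _ Xs Xx Ys l0 l1; rewrite hsubmxK.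
move=> e e0; near=> l.
have l0 : 0 < l by near: l; exact: nbhs_right_gt.
have l1 : l <= 1 by near: l; exact: nbhs_right_le.
rewrite mulr0 subr0.
have Xl := polyhedron_segment _ _ _ _ _ _ X_polyhedron Xx Xs (ltW l0) l1.
have [_] := sad _ _ Xl Ys; rewrite -subr_ge0; apply: le_trans.
by rewrite oppr_le0 mulr_ge0 // ltW.
Unshelve. all: by end_near. Qed.

Lemma saddle_growth_y zs y : saddle_point X Y S zs -> Y y ->
  q / 2 * dotp (y - rsubmx zs) (y - rsubmx zs) <= S zs - S (row_mx (lsubmx zs) y).
Proof.
move=> [[Xs Ys] sad] Yy.
have /= := @strong_convexity_slope R
  (fun l => - S (row_mx (lsubmx zs) (rsubmx zs + l *: (y - rsubmx zs)))) 0
  (q / 2 * dotp (y - rsubmx zs) (y - rsubmx zs)).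
rewrite scale0r addr0 scale1r subrKC hsubmxK add0r => slope.
suff : q / 2 * dotp (y - rsubmx zs) (y - rsubmx zs)
    <= - S (row_mx (lsubmx zs) y) - - S zs by lra.
apply: slope.
  by move=> l l0 l1; have := strongly_concave_segment_y _ _ _ _ Xs Ys Yy l0 l1; rewrite hsubmxK.
move=> e e0; near=> l.
have l0 : 0 < l by near: l; exact: nbhs_right_gt.
have l1 : l <= 1 by near: l; exact: nbhs_right_le.
rewrite mulr0 subr0.
have Yl := polyhedron_segment _ _ _ _ _ _ Y_polyhedron Yy Ys (ltW l0) l1.
have [+ _] := sad _ _ Xs Yl; have : 0 <= e * l by rewrite mulr_ge0 // ltW.
lra.
Unshelve. all: by end_near. Qed.

(** The two growth bounds at [zs] add up to at most [S(xs', ys) - S(xs, ys')], which is nonpositive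
    because [zs'] is a saddle point; both squared distances therefore vanish. *)
Lemma saddle_unique zs zs' : 0 < mu -> 0 < q ->
  saddle_point X Y S zs -> saddle_point X Y S zs' -> zs = zs'.
Proof.
move=> mu0 q0 sz sz'.
have [[Xs Ys] sad] := sz; have [[Xs' Ys'] sad'] := sz'.
have := saddle_growth_x _ _ sz Xs'; have := saddle_growth_y _ _ sz Ys'.
have [l1 _] := sad' _ _ Xs Ys; have [_ l2] := sad' _ _ Xs Ys => gy gx.
set A := dotp _ _ in gx; set B := dotp _ _ in gy.
have A0 : 0 <= A := dotp_ge0 _; have B0 : 0 <= B := dotp_ge0 _.
have muA : 0 <= mu / 2 * A by rewrite mulr_ge0 // divr_ge0 // ltW.
have qB : 0 <= q / 2 * B by rewrite mulr_ge0 // divr_ge0 // ltW.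
have : mu / 2 * A = 0 by lra.
have : q / 2 * B = 0 by lra.
move/eqP; rewrite mulf_eq0 gt_eqF ?divr_gt0 //= dotp_eq0 subr_eq0 => /eqP eqy.
move/eqP; rewrite mulf_eq0 gt_eqF ?divr_gt0 //= dotp_eq0 subr_eq0 => /eqP eqx.
by rewrite -[zs]hsubmxK -[zs']hsubmxK eqx eqy.
Qed.

(** The left side is half the derivative of the squared distance along the flow. The gradient
    inequalities and the growth at [zs] each contribute [mu / 2] and [q / 2], which gives the full
    rate. *)
Lemma saddle_flow_dissipation zs z : saddle_point X Y S zs -> prod_set X Y z ->
  dotp (lsubmx z - lsubmx zs) (proj_dir X (lsubmx z) (- lsubmx (gS z))) +
  dotp (rsubmx z - rsubmx zs) (proj_dir Y (rsubmx z) (rsubmx (gS z)))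
    <= - (Num.min mu q * dotp (z - zs) (z - zs)).
Proof.
move=> sz [Xz Yz]; have [[Xs Ys] _] := sz.
have px := proj_dir_polyhedron _ _ _ _ (- lsubmx (gS z)) _ X_polyhedron Xz Xs.
have py := proj_dir_polyhedron _ _ _ _ (rsubmx (gS z)) _ Y_polyhedron Yz Ys.
have gx := strong_gradient_x _ _ _ Xz Xs Yz.
have gy := strong_gradient_y _ _ _ Xz Yz Ys.
have sx := saddle_growth_x _ _ sz Xz; have sy := saddle_growth_y _ _ sz Yz.
rewrite dotp_submx !linearB /=.
rewrite -(opprB (lsubmx z)) hsubmxK in px gx.
rewrite -(opprB (rsubmx z)) hsubmxK in py gy.
move: (lsubmx z - lsubmx zs) (rsubmx z - rsubmx zs) => u w in px py gx gy sx sy *.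
rewrite !dotpE in px py gx gy.
have minx : Num.min mu q * dotp u u <= mu * dotp u u.
  by rewrite ler_wpM2r ?dotp_ge0 // ge_min lexx.
have miny : Num.min mu q * dotp w w <= q * dotp w w.
  by rewrite ler_wpM2r ?dotp_ge0 // ge_min lexx orbT.
rewrite (dotpC _ u) in gx; rewrite (dotpC _ w) in gy.
lra.
Qed.

End saddle.

(** * Exponential decay along trajectories *)

Lemma is_derive_sqr_dist (R : realType) n (z : R -> 'rV[R]_n) (c v : 'rV[R]_n) (t : R) :
  is_derive t 1 z v ->
  is_derive t 1 (fun s => dotp (z s - c) (z s - c)) (2 * dotp (z t - c) v).
Proof.
move=> [dz <-].
have dzi i : is_derive t 1 (fun s => (z s - c) 0 i) ('D_1 z t 0 i).
  rewrite derive_mx // mxE; under eq_fun do rewrite !mxE.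
  have := is_deriveB (DeriveDef ((derivable_mxP _ _ _).1 dz 0 i) erefl)
    (is_derive_cst (c 0 i) t 1).
  by rewrite subr0.
have := is_derive_sum (fun i => is_deriveM (dzi i) (dzi i)).
congr (is_derive _ _ _ _).
  by apply/funext => s; rewrite fct_sumE.
rewrite mulr_sumr; apply: eq_bigr => i _.
by rewrite mulr_natl mulr2n.
Qed.

(** The exponential lies above its tangent at [v], so the increment from [u] to [v] is at most the
    slope at [v] times [v - u]; that slope is largest at [b]. *)
Lemma ac_on_expR (R : realType) (a b k : R) : 0 <= k ->
  ac_on a b (fun t => expR (k * t)).
Proof.
move=> k0; apply: (@ac_on_lipschitz _ _ _ _ (expR (k * b) * k)) => u v _ uv vb.
have kuv : k * u <= k * v by rewrite ler_wpM2l.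
rewrite ger0_norm ?subr_ge0 ?ler_expR //.
have := expR_ge1Dx (k * u - k * v); rewrite -(ler_pM2l (expR_gt0 (k * v))).
rewrite -expRD subrKC => uv1.
apply: (@le_trans _ _ (expR (k * v) * (k * (v - u)))); first by lra.
rewrite -mulrA ler_wpM2r ?ler_expR ?ler_wpM2l //.
by rewrite mulr_ge0 // subr_ge0.
Qed.

Theorem theorem16 (R : realType) (n m : nat)
  (X : set 'rV[R]_n) (Y : set 'rV[R]_m)
  (S : 'rV[R]_(n + m) -> R) (gS : 'rV[R]_(n + m) -> 'rV[R]_(n + m))
  (mu q : R)
  (X_polyhedron : polyhedron X) (Y_polyhedron : polyhedron Y)
  (S_convex_concave : convex_concave X Y S)
  (S_gradient : gradient_on (prod_set X Y) S gS)
  (gS_continuous : {within prod_set X Y, continuous gS})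
  (gS_lipschitz : lipschitz_on_set (prod_set X Y) gS)
  (S_saddle : exists zs, saddle_point X Y S zs)
  (mu_gt0 : 0 < mu) (q_gt0 : 0 < q)
  (S_strongly_convex : strongly_convex_x mu X Y S)
  (S_strongly_concave : strongly_concave_y q X Y S) :
  [/\ 0 < Num.min mu q,
      exists! zs, saddle_point X Y S zs &
      forall zs, saddle_point X Y S zs ->
      forall z : R -> 'rV[R]_(n + m), saddle_flow_solution X Y gS z ->
      forall t : R, 0 <= t ->
        enorm (z t - zs) <= enorm (z 0 - zs) * expR (- (Num.min mu q * t))].
Proof.
have c0 : 0 < Num.min mu q by rewrite lt_min mu_gt0.
split => //.
  have [zs sz] := S_saddle; exists zs; split => // zs'.
  exact: (saddle_unique R n m X Y S mu q).
move=> zs sz z [acz zD flow] t t0.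
set c := Num.min mu q in c0 *.
pose N s := enorm (z s - zs); pose E s := expR (2 * c * s).
(* The square is written as a product of norms, so that its absolute continuity follows from that of
   the distance. *)
pose V := (N \* N) \* E.
have c2 : 0 <= 2 * c by rewrite mulr_ge0 // ltW.
have acV : ac_on 0 t V.
  apply: ac_on_mul; last exact: ac_on_expR.
  by apply: ac_on_mul; apply: ac_on_enorm; exact: acz.
have dV : {ae lebesgue_measure, forall s, 0 <= s -> s <= t ->
    exists2 l : R, is_derive s 1 V l & l <= 0}.
  (* Every exceptional time of [V] is an exceptional time of the flow equations. *)
  apply: negligibleS flow => s; apply: contra_not => flow s0 _.
  have [dx dy] := flow s0.
  have dE : is_derive s 1 E (E s * (2 * c)).
    have := is_derive1_comp (is_derive_expR (2 * c * s))
      (is_deriveZ (2 * c) (is_derive_id s (1 : R))).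
    by rewrite /GRing.scale /= mulr1.
  have := is_deriveM (is_deriveD (is_derive_sqr_dist _ _ _ (lsubmx zs) _ _ dx)
    (is_derive_sqr_dist _ _ _ (rsubmx zs) _ _ dy)) dE.
  set l := (l in is_derive _ _ _ l) => dV.
  exists l.
    congr (is_derive _ _ _ _): dV; apply/funext => r.
    by rewrite /V /N /= -expr2 sqr_enorm dotp_submx !linearB.
  have := saddle_flow_dissipation _ _ _ _ _ _ _ _ _ X_polyhedron Y_polyhedron S_gradient
    S_strongly_convex S_strongly_concave _ _ sz (zD s s0).
  rewrite dotp_submx !linearB /l fctE /GRing.scale /=.
  set B := dotp _ _ + dotp _ _; set A := dotp _ _ + dotp _ _ => diss.
  (* The derivative [l] of [V] equals [2 * E s * (c * A + B)]. *)
  have : E s * (c * A + B) <= 0 by rewrite mulr_ge0_le0 ?expR_ge0 // /c; lra.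
  by rewrite /A /B; lra.
have := ac_on_nonincreasing _ _ _ t0 acV dV.
rewrite /V /N /E /= mulr0 expR0 mulr1 => decay.
(* Squaring and multiplying by [expR (2 * c * t)] cancels the decay factor and leaves
   [V t <= V 0]. *)
rewrite -ler_sqr ?nnegrE ?mulr_ge0 ?enorm_ge0 ?expR_ge0 // exprMn.
rewrite -(ler_pM2r (expR_gt0 (2 * c * t))) -[leRHS]mulrA -expRM_natl -expRD.
by rewrite mulrN mulrA addNr expR0 mulr1 !expr2.
Qed.
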